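(* Let $\mathfrak{a}=(z^{\alpha^1},\dots,z^{\alpha^k})$ be a monomial ideal in $\mathbb{C}[z_1,\dots,z_n]$, with multi-indices $\alpha^1,\dots,\alpha^k\in(\mathbb{N}\cup\{0\})^n$. Given $f\in\mathbb{C}[z_1,\dots,z_n]$, the following are equivalent: (a) $f\in\overline{\mathfrak{a}}^{an}$ (the analytic integral closure of $\mathfrak{a}$). (b) $f\in\overline{\mathfrak{a}}^{al}$ (the algebraic integral closure of $\mathfrak{a}$). (c) There exists a non-zero ideal $\mathfrak{b}\subset\mathbb{C}[z_1,\dots,z_n]$ such that $f\cdot\mathfrak{b}\subset\mathfrak{a}\cdot\mathfrak{b}$.
   Context: A monomial ideal is an ideal of $\mathbb{C}[z_1,\dots,z_n]$ generated by monomials $z^{\alpha}=z_1^{\alpha_1}\cdots z_n^{\alpha_n}$, $\alpha\in(\mathbb{N}\cup\{0\})^n$; here $k\ge 1$, so $\mathfrak{a}\neq 0$. Analytic integral closure: for a non-zero ideal $\mathfrak{a}=(p_1,\dots,p_k)\subset\mathbb{C}[z_1,\dots,z_n]$, a polynomial $f\in\mathbb{C}[z_1,\dots,z_n]$ belongs to $\overline{\mathfrak{a}}^{an}$ if for any $q\in\mathbb{C}^n$ there exist a neighborhood $\mathcal{V}$ of $q$ and a constant $C>0$ such that $|f(z)|\le C\sum_{i=1}^k|p_i(z)|$ for all $z\in\mathcal{V}$. Algebraic integral closure: for a non-zero ideal $\mathfrak{a}\subset\mathbb{C}[z_1,\dots,z_n]$, a polynomial $f\in\mathbb{C}[z_1,\dots,z_n]$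 belongs to $\overline{\mathfrak{a}}^{al}$ if there exist an integer $N\ge 1$ and elements $b_j\in\mathfrak{a}^j$, $j=1,\dots,N$, such that $f^N+b_1f^{N-1}+\dots+b_{N-1}f+b_N=0$. Here $\mathfrak{a}^j$ is the $j$-th power of the ideal $\mathfrak{a}$. *)

(* Defs.v *)
From mathcomp Require Import all_boot all_order all_algebra.
From mathcomp Require Import classical_sets reals topology normedtype.
From mathcomp Require Import complex.
(* The notations of mpoly clash with those of classical_sets: here
   mpoly n K is K[z_1, ..., z_n], multinom n is the type of multi-indices,
   mpolyX K m is the monomial z^m, and meval v p is the value of p at v. *)
From mathcomp Require Import -(notations) mpoly.

Set Implicit Arguments.
Unset Strict Implicit.
Unset Printing Implicit Defensive.

Import Order.TTheory GRing.Theory Num.Theory.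
Import numFieldNormedType.Exports.

Local Open Scope classical_set_scope.
Local Open Scope ring_scope.
Local Open Scope complex_scope.

Section Ideals.
Variable A : comNzRingType.
Implicit Types (I J S : set A) (f : A).

(* Unlike idealr_closed in ring_quotient, the unit ideal is allowed. *)
Definition is_ideal I : Prop :=
  [/\ I 0,
      forall x y, I x -> I y -> I (x + y)
    & forall a x, I x -> I (a * x)].

Definition ideal_gen S : set A := smallest is_ideal S.

Definition ideal_mul I J : set A := ideal_gen [set x * y | x in I & y in J].

Fixpoint ideal_exp I (j : nat) : set A :=
  if j is j'.+1 then ideal_mul I (ideal_exp I j') else setT.

Definition al_closure I f : Prop :=
  exists (N : nat) (b : nat -> A),
    [/\ (1 <= N)%N,
        forall j, (1 <= j <= N)%N -> ideal_exp I j (b j)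
      & f ^+ N + \sum_(1 <= j < N.+1) b j * f ^+ (N - j) = 0].

End Ideals.

Section AnalyticClosure.
Variables (R : realType) (n : nat).

(* The ideal is given by its generators p_1, ..., p_k. C^n is 'rV[R[i]^o]_n:
   R[i]^o is R[i], with the topology that every numFieldType carries on its
   regular module. *)
Definition an_closure (k : nat) (p : 'I_k -> mpoly n R[i])
    (f : mpoly n R[i]) : Prop :=
  forall q : 'rV[R[i]^o]_n, exists2 C : R, 0 < C &
    nbhs q [set z : 'rV[R[i]^o]_n |
      `|meval (z 0) f| <= C%:C * \sum_(i < k) `|meval (z 0) (p i)| ].

End AnalyticClosure.

(* Main.v *)
Require Import Defs.
From mathcomp Require Import all_boot all_order all_algebra.
From mathcomp Require Import perm.
From mathcomp Require Import classical_sets reals topology normedtype.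
From mathcomp Require Import boolp complex.
From mathcomp Require Import -(notations) mpoly.
From mathcomp Require Import ring lra zify.

Set Implicit Arguments.
Unset Strict Implicit.
Unset Printing Implicit Defensive.

Import Order.TTheory GRing.Theory Num.Theory.
Import numFieldNormedType.Exports.

Local Open Scope classical_set_scope.
Local Open Scope ring_scope.
Local Open Scope complex_scope.

(** A monomial z^m is integral over a = (z^{alpha^1}, ..., z^{alpha^k}) exactly
when m lies in the Newton polyhedron of a, the set of exponents that dominate a
convex combination of the alpha^i.  All three conditions on f turn out to say
that every exponent m of f lies there.  The link is the dual description of
the polyhedron by weights: for every w in N^n, some alpha^i satisfies
w.alpha^i <= w.m.

Each of the two weak conditions gives the weight inequalities.
- If f is in the analytic closure, restrict the estimate at the origin to the
  curve z_j = t^{v_j}, t -> 0+.  Here v is a positive weight that refines w and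
  separates the exponents of f, so that a single monomial dominates f on the
  curve ([refine_weights], [curve_lower_bound], [weights_of_an_closure]).
- If f b is contained in a b with b nonzero, the least w-degree of the terms
  of a polynomial is additive on products, because the w-initial forms multiply
  in a domain.  Choosing g in b of least possible w-order and comparing the
  orders of f g and of a b gives the inequality ([weights_of_module]).

Conversely, the weight inequalities give exponents in the Newton polyhedron P
by a theorem of the alternative ([ville], [newton_of_weights]).  The monomials
with exponent in k P then span an ideal b with f b contained in a b: an
exponent of (k + 1) P is bounded below by a combination of the k vectors
alpha^i whose coefficients add up to k + 1, so one of the coefficients is at
least 1, and the corresponding alpha^i can be split off, leaving an exponent
of k P ([newton_step]).  Finitely many of those monomials, with exponents in a
fixed box, already generate b ([newton_module]).  This b is the ideal required
in (c), and being finitely generated it also yields an equation of integral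
dependence for f, by Cayley's determinant trick ([determinant_trick]).

Finally, an equation of integral dependence bounds |f| by a constant times
sum_i |p_i| on every bounded set, for arbitrary generators p_i
([an_closure_of_al_closure]).  Hence (b) => (a) => weights => (b) and (c), and
(c) => weights. *)

(** * Powers of ideals and the determinant trick *)

Section IdealTheory.
Variable A : comNzRingType.
Implicit Types (I S : set A).

Lemma ideal_gen_ideal S : is_ideal (ideal_gen S).
Proof.
split=> [I [[]] // | x y Sx Sy I SI | a x Sx I SI].
- by case: (SI) => -[_ ID _] _; apply: ID; [apply: Sx | apply: Sy].
- by case: (SI) => -[_ _ IM] _; apply: IM; apply: Sx.
Qed.

Lemma sub_ideal_gen S : S `<=` ideal_gen S.
Proof. by move=> x Sx I [_ SI]; apply: SI. Qed.

Lemma ideal_gen_min S I : is_ideal I -> S `<=` I -> ideal_gen S `<=` I.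
Proof. by move=> Iid SI x; apply; split. Qed.

Lemma ideal_mul_mem I J x y : I x -> J y -> ideal_mul I J (x * y).
Proof. by move=> Ix Jy; apply: sub_ideal_gen; exists x => //; exists y. Qed.

Lemma ideal_sum I (T : Type) (r : seq T) (P : pred T) (F : T -> A) :
  is_ideal I -> (forall i, P i -> I (F i)) -> I (\sum_(i <- r | P i) F i).
Proof. by case=> I0 ID _ IF; apply: (big_ind I). Qed.

Lemma ideal_exp_ideal I j : is_ideal (ideal_exp I j).
Proof. by case: j => [|j]; [split | apply: ideal_gen_ideal]. Qed.

Lemma ideal_exp1 I x : I x -> ideal_exp I 1 x.
Proof. by move=> Ix; rewrite -[x]mulr1; apply: ideal_mul_mem. Qed.

Lemma ideal_exp_mul I i j x y :
  ideal_exp I i x -> ideal_exp I j y -> ideal_exp I (i + j) (x * y).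
Proof.
elim: i x => [|i IHi] x Ix Iy.
  by have [_ _ IM] := ideal_exp_ideal I j; apply: IM.
have [I0 ID IM] := ideal_exp_ideal I (i.+1 + j).
apply: (@ideal_gen_min _ [set x | ideal_exp I (i.+1 + j) (x * y)]) Ix.
  split=> /= [|u v Iu Iv|u v Iv]; first by rewrite mul0r.
    by rewrite mulrDl; apply: ID.
  by rewrite -mulrA; apply: IM.
move=> _ [u Iu [v Iv <-]] /=; rewrite -mulrA.
by apply: ideal_mul_mem => //; apply: IHi.
Qed.

End IdealTheory.

Section DeterminantTrick.
Variable A : comNzRingType.
Variable a : set A.

(** Homogeneous elements of degree [d] of the extended Rees algebra, with 'X
and [a] both in degree 1: the coefficient of 'X^i lies in a^(d - i).  The
grading is what keeps track of the powers of [a] in a determinant. *)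
Definition rees_poly (d : nat) (P : {poly A}) : Prop :=
  (size P <= d.+1)%N /\ forall i, (i <= d)%N -> ideal_exp a (d - i) P`_i.

Lemma rees_poly1 : rees_poly 0 1.
Proof. by split=> //; rewrite size_poly1. Qed.

Lemma rees_poly_mul d e P Q :
  rees_poly d P -> rees_poly e Q -> rees_poly (d + e) (P * Q).
Proof.
move=> [sP aP] [sQ aQ]; split=> [|i le_i].
  by apply: leq_trans (size_polyMleq _ _) _; lia.
rewrite coefM; apply: ideal_sum => [|[j /= lt_j] _]; first exact: ideal_exp_ideal.
have [E0 _ _] := ideal_exp_ideal a (d + e - i).
have [lt_dj | le_jd] := ltnP d j.
  by rewrite nth_default ?mul0r//; apply: leq_trans lt_dj.
have [lt_ej | le_je] := ltnP e (i - j).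
  by rewrite [Q`__]nth_default ?mulr0//; apply: leq_trans lt_ej.
have -> : (d + e - i = (d - j) + (e - (i - j)))%N by lia.
by apply: ideal_exp_mul; [apply: aP | apply: aQ].
Qed.

Lemma rees_poly_prod (I : eqType) (r : seq I) (F : I -> {poly A}) :
  (forall i, rees_poly 1 (F i)) -> rees_poly (size r) (\prod_(i <- r) F i).
Proof.
move=> aF; elim: r => [|i r IHr]; first by rewrite big_nil; apply: rees_poly1.
by rewrite big_cons; apply: (@rees_poly_mul 1).
Qed.

Lemma rees_poly_det n (M : 'M[{poly A}]_n) :
  (forall i j, rees_poly 1 (M i j)) -> rees_poly n (\det M).
Proof.
move=> aM.
have aT (s : 'S_n) : rees_poly n ((-1) ^+ s * \prod_i M i (s i)).
  have [] : rees_poly n (\prod_i M i (s i)).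
    have := rees_poly_prod (index_enum 'I_n) (fun i => aM i (s i)).
    by rewrite /index_enum -enumT size_enum_ord.
  rewrite -signr_odd; case: odd => sP aP; last by rewrite expr0 mul1r.
  rewrite expr1 mulN1r; split=> [|i le_i]; first by rewrite size_polyN.
  have [_ _ EM] := ideal_exp_ideal a (n - i).
  by rewrite coefN -mulN1r; apply: EM; apply: aP.
split=> [|i le_i].
  apply: leq_trans (size_sum _ _ _) _; apply/bigmax_leqP=> s _.
  by have [] := aT s.
rewrite coef_sum; apply: ideal_sum => [|s _]; first exact: ideal_exp_ideal.
by have [_] := aT s; apply.
Qed.

Lemma rees_poly_char_poly n (M : 'M[A]_n) :
  is_ideal a -> (forall i j, a (M i j)) -> rees_poly n (char_poly M).
Proof.
move=> [_ _ aM] Ma; apply: rees_poly_det => i j; rewrite !mxE; split.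
  apply: leq_trans (size_polyD _ _) _; rewrite size_polyN geq_max.
  rewrite (leq_trans (size_polyC_leq1 _))// andbT.
  by case: eqP; rewrite ?mulr1n ?mulr0n ?size_polyX ?size_poly0.
case=> [_|[|//] _ //]; rewrite coefB coefC eqxx coefMn coefX mul0rn sub0r.
by apply: ideal_exp1; rewrite -mulN1r; apply: aM.
Qed.

End DeterminantTrick.

(** Multiplication by [f] acts on the vector of the generators through a matrix
[M] with entries in [a], so det (f - M) annihilates each of them, hence
vanishes in a domain with some nonzero generator.  The characteristic
polynomial of [M] is thus an equation for [f], and it is homogeneous for the
Rees grading, which is the condition on the coefficients in the definition of
the integral closure. *)
Lemma determinant_trick (A : idomainType) (a : set A) (f : A)
    (T : finType) (g : T -> A) (t0 : T) :
  is_ideal a -> g t0 != 0 ->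
  (forall t, exists2 c : T -> A, forall s, a (c s)
                               & f * g t = \sum_s c s * g s) ->
  al_closure a f.
Proof.
move=> aI g0 /(_ _)/cid2-/all_sig2[c ca fg].
pose M : 'M[A]_#|T| := \matrix_(i, j) c (enum_val i) (enum_val j).
pose v : 'cV[A]_#|T| := \col_i g (enum_val i).
pose N := f%:M - M.
have Nv : N *m v = 0.
  apply/matrixP=> i j; rewrite mulmxBl mul_scalar_mx !mxE fg.
  rewrite (reindex (@enum_val T T)) /=; last exact/onW_bij/enum_val_bij.
  apply/eqP; rewrite subr_eq0; apply/eqP/eq_bigr=> s _.
  by rewrite !mxE.
have detN : \det N = 0.
  have : \det N *: v = 0 by rewrite -mul_scalar_mx -mul_adj_mx -mulmxA Nv mulmx0.
  move/matrixP/(_ (enum_rank t0) 0); rewrite !mxE enum_rankK => /eqP.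
  by rewrite mulf_eq0 (negPf g0) orbF => /eqP.
have charf : (char_poly M).[f] = 0.
  rewrite -[_.[f]]/(horner_eval f _) -det_map_mx -[RHS]detN; congr (\det _).
  apply/matrixP=> i j; rewrite !mxE rmorphB rmorphMn /= /horner_eval.
  by rewrite hornerC hornerX.
have [sM Ma] : rees_poly a #|T| (char_poly M).
  by apply: rees_poly_char_poly => // i j; rewrite mxE.
have T0 : (0 < #|T|)%N by apply/card_gt0P; exists t0.
exists #|T|, (fun j => (char_poly M)`_(#|T| - j)); split=> //.
  move=> j /andP[_ le_j]; rewrite -{1}(subKn le_j).
  by apply: Ma; apply: leq_subr.
have lead : (char_poly M)`_#|T| = 1.
  by have /monicP := char_poly_monic M; rewrite lead_coefE size_char_poly.
rewrite -[RHS]charf horner_coef size_char_poly big_ord_recr /= lead mul1r addrC.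
congr (_ + _); rewrite big_add1 /= big_nat_rev /= big_mkord.
apply: eq_bigr => i _; rewrite add0n.
by rewrite subnSK ?subKn // ltnW.
Qed.

(** * A theorem of the alternative for systems of linear inequalities *)

Lemma seq_max (F : realFieldType) (x0 : F) (s : seq F) :
  exists2 m, m \in x0 :: s & forall x, x \in x0 :: s -> x <= m.
Proof.
elim: s x0 => [|y s IHs] x0.
  by exists x0 => [|x]; rewrite ?mem_head// inE => /eqP->.
have [m my le_m] := IHs y; have [le_x|lt_m] := leP x0 m.
  exists m => [|x]; first by rewrite inE my orbT.
  by rewrite inE => /orP[/eqP->//|]; apply: le_m.
exists x0 => [|x]; first exact: mem_head.
by rewrite inE => /orP[/eqP->//|/le_m xm]; apply: le_trans xm (ltW lt_m).
Qed.

(** Only the lower side needs a distinguished member [x0]: in the use below it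
is the constraint that the separating value be nonnegative. *)
Lemma seq_between (F : realFieldType) (x0 : F) (s1 s2 : seq F) :
  (forall x y, x \in x0 :: s1 -> y \in s2 -> x < y) ->
  exists t, (forall x, x \in x0 :: s1 -> x < t) /\ (forall y, y \in s2 -> t < y).
Proof.
have [m m1 le_m] := seq_max x0 s1; case: s2 => [_|y s2 lt12].
  exists (m + 1); split=> // x /le_m; lra.
have [m' m2 le_m'] := seq_max (- y) [seq - z | z <- s2].
have lt_m : m < - m'.
  by apply: lt12 => //; rewrite -(mem_map oppr_inj) opprK.
exists ((m - m') / 2); split=> [x /le_m|z z2]; first by lra.
have /le_m' : - z \in - y :: [seq - z | z <- s2].
  by rewrite -(mem_map oppr_inj) in z2.
lra.
Qed.

(** Ville's theorem, by Fourier-Motzkin elimination of the last coordinate.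
Two vectors of the family, the second with nonpositive last coordinate, are
combined so that the last coordinate becomes nonpositive.  If the combinations
admit a weight on the first [n] coordinates, it extends to the last one, since
the combinations express precisely that the lower bounds on the new value are
less than the upper bounds.  Having an abstract cone [C] that contains the
family, instead of explicit multipliers, lets the induction replace the family
by the combinations and [C] by its part with nonpositive last coordinate, with
no bookkeeping of coefficients. *)
Lemma ville (F : realFieldType) n : forall (C : (nat -> F) -> Prop)
    (I : finType) (P : pred I) (v : I -> nat -> F),
  (forall x y u u', 0 <= x -> 0 < y -> C u -> C u' ->
     C (fun j => x * u j + y * u' j)) ->
  (forall i, P i -> C (v i)) ->
  (exists2 w : nat -> F, forall j, 0 <= w j &
     forall i, P i -> 0 < \sum_(j < n) w j * v i j) \/
  (exists2 u, C u & forall j, (j < n)%N -> u j <= 0).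
Proof.
elim: n => [|n IHn] C I P v Ccone Cv.
  have [i Pi|P0] := pickP P; first by right; exists (v i) => //; apply: Cv.
  by left; exists (fun=> 0) => // i; rewrite P0.
(* When v p n <= 0 the combination of p and q is v q itself. *)
pose x p q := if 0 < v p n then - v q n else 0.
pose y p := if 0 < v p n then v p n else 1.
have y_gt0 p : 0 < y p by rewrite /y; case: ifP.
pose P2 pq := [&& P pq.1, P pq.2 & v pq.2 n <= 0].
pose v2 pq j := x pq.1 pq.2 * v pq.1 j + y pq.1 * v pq.2 j.
have x_ge0 p q : v q n <= 0 -> 0 <= x p q.
  by rewrite /x; case: ifP => // _ ?; rewrite oppr_ge0.
case: (IHn (fun u => C u /\ u n <= 0) _ P2 v2)
  => [a b u u' a0 b0 [Cu un] [Cu' un']|[p q]|[w w0 wP2]|[u [Cu un] u0]].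
- by split; [apply: Ccone | nra].
- rewrite /P2 /= => /and3P[Pp Pq qn]; split.
    by apply: Ccone; rewrite ?x_ge0//; apply: Cv.
  by rewrite /v2 /= /x /y; case: ifP => _; nra.
- left; pose S i := \sum_(j < n) w j * v i j.
  have wv2 p q : P p -> P q -> v q n <= 0 -> 0 < x p q * S p + y p * S q.
    move=> Pp Pq qn; have := wP2 (p, q) (introT and3P (And3 Pp Pq qn)).
    rewrite /v2 /= /S !mulr_sumr -big_split /=; congr (_ < _).
    by apply: eq_bigr => j _; ring.
  have SN q : P q -> v q n <= 0 -> 0 < S q.
    move=> Pq qn; have := wv2 q q Pq Pq qn.
    by rewrite /x /y (le_gtF qn) mul0r add0r mul1r.
  have SPN p q : P p -> P q -> 0 < v p n -> v q n < 0 ->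
      - S p / v p n < S q / - v q n.
    move=> Pp Pq pn qn; have := wv2 p q Pp Pq (ltW qn); rewrite /x /y pn => S2.
    by rewrite ltr_pdivrMr// mulrAC ltr_pdivlMr ?oppr_gt0//; lra.
  have [x1 x2|t [lt1 lt2]] := @seq_between F 0
    [seq - S p / v p n | p in [pred p | P p & 0 < v p n]]
    [seq S q / - v q n | q in [pred q | P q & v q n < 0]].
    move=> x1s /fintype.imageP[q /andP[Pq qn] ->]; move: x1s.
    rewrite inE => /orP[/eqP->|].
      by apply: divr_gt0; [apply: SN => //; apply: ltW | rewrite oppr_gt0].
    by move=> /fintype.imageP[p /andP[Pp pn] ->]; apply: SPN.
  exists (fun j => if j == n then t else w j) => [j|i Pi].
    by case: eqP => // _; apply/ltW/lt1/mem_head.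
  rewrite big_ord_recr /= eqxx (_ : \sum_(j < n) _ = S i); last first.
    by apply: eq_bigr => j _; rewrite (ltn_eqF (ltn_ord j)).
  have [vn|vn|vn] := ltgtP (v i n) 0.
  + have : t < S i / - v i n.
      by apply: lt2; apply/fintype.imageP; exists i => //; apply/andP.
    by rewrite ltr_pdivlMr ?oppr_gt0//; lra.
  + have : - S i / v i n < t.
      apply: lt1; rewrite inE; apply/orP; right; apply/fintype.imageP.
      by exists i => //; apply/andP.
    by rewrite ltr_pdivrMr//; lra.
  + by rewrite vn mulr0 addr0; apply: SN; rewrite ?vn.
- right; exists u => // j; rewrite ltnS leq_eqVlt => /orP[/eqP->//|]; exact: u0.
Qed.

Lemma sum_delta_mul (R : pzSemiRingType) (I : finType) (i : I) (F : I -> R) :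
  \sum_i' (i' == i)%:R * F i' = F i.
Proof.
rewrite (bigD1 i)//= eqxx mul1r big1 ?addr0// => i' /negPf->.
by rewrite mul0r.
Qed.

Lemma sum_delta (R : pzSemiRingType) (I : finType) (i : I) :
  \sum_i' (i' == i)%:R = 1 :> R.
Proof. by have := sum_delta_mul i (fun=> 1 : R); under eq_bigr do rewrite mulr1. Qed.

Lemma clear_denominators n (w : 'I_n -> rat) : (forall j, 0 <= w j) ->
  exists2 d : nat, (0 < d)%N &
    exists w' : 'I_n -> nat, forall j, (w' j)%:R = d%:R * w j.
Proof.
move=> w0; exists (\prod_j `|denq (w j)|)%N.
  by rewrite prodn_gt0// => j; rewrite absz_gt0 denq_neq0.
exists (fun j => \prod_(i | i != j) `|denq (w i)| * `|numq (w j)|)%N => j.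
have natr_absz (z : int) : (0 <= z)%R -> `|z|%N%:R = z%:~R :> rat.
  by move=> z0; rewrite -[in RHS](gez0_abs z0).
rewrite [in RHS](bigD1 j)//= !natrM [LHS]mulrC -mulrA [in RHS]mulrCA.
rewrite !natr_absz ?numq_ge0 ?denq_ge0//; first by rewrite numqE; ring.
Qed.

(** * Newton polyhedra *)

Section NewtonPolyhedron.
Variables (n k : nat) (alpha : 'I_k -> multinom n).

Definition wdeg (w : 'I_n -> nat) (m : multinom n) : nat := \sum_j w j * m j.

(** The exponents in the dilation by [L] of the Newton polyhedron.  Rational
multipliers suffice, the polyhedron being rational. *)
Definition newton (L : nat) (m : multinom n) : Prop :=
  exists mu : 'I_k -> rat, [/\ forall i, 0 <= mu i, \sum_i mu i = L%:R
    & forall j, \sum_i mu i * (alpha i j)%:R <= (m j)%:R].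

(** The alternative of [ville] for the vectors alpha^i - m: a weight that is
positive on all of them becomes, once its denominators are cleared, a weight
in N^n that violates the hypothesis. *)
Lemma newton_of_weights (m : multinom n) :
  (forall w, exists i, (wdeg w (alpha i) <= wdeg w m)%N) -> newton 1 m.
Proof.
move=> wm; pose v i j : rat := (nth 0%N (alpha i) j)%:R - (nth 0%N m j)%:R.
pose C (u : nat -> rat) := exists mu : 'I_k -> rat,
  [/\ forall i, 0 <= mu i, 0 < \sum_i mu i & forall j, u j = \sum_i mu i * v i j].
have [x y u u' x0 y0 [mu [mu0 smu umu]] [nu [nu0 snu unu]]|i _|[w w0 wv]
  |[u [mu [mu0 smu umu]] u0]] := @ville rat n C 'I_k predT v.
- exists (fun i => x * mu i + y * nu i); split=> [i||j].
  + by rewrite addr_ge0// mulr_ge0// ltW.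
  + rewrite big_split /= -!mulr_sumr.
    by apply: ltr_wpDl; [rewrite mulr_ge0// ltW | apply: mulr_gt0].
  + by rewrite umu unu !mulr_sumr -big_split; apply: eq_bigr => i _ /=; ring.
- exists (fun i' => (i' == i)%:R); split=> [i'||j]; first by rewrite ler0n.
    by rewrite sum_delta.
  by rewrite sum_delta_mul.
- have [d d0 [w' w'E]] := clear_denominators (fun j : 'I_n => w0 j).
  have [i ] := wm w'; rewrite leqNgt => /negP[].
  rewrite -(ltr_nat rat) -subr_gt0 !natr_sum -sumrB.
  have d0' : 0 < d%:R :> rat by rewrite ltr0n.
  have := mulr_gt0 d0' (wv i isT); rewrite mulr_sumr.
  congr (_ < _); apply: eq_bigr => j _.
  by rewrite !natrM !w'E /v -!mnm_nth; ring.
exists (fun i => mu i / \sum_i mu i); split=> [i||j].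
- by rewrite divr_ge0// ltW.
- by rewrite -mulr_suml divff// gt_eqF.
have := u0 j (ltn_ord j); rewrite umu.
under eq_bigr do rewrite /v -!mnm_nth mulrBr.
rewrite sumrB -mulr_suml subr_le0 => muj.
under eq_bigr do rewrite mulrAC.
by rewrite -mulr_suml ler_pdivrMr// mulrC.
Qed.

(** The dilation factor [k] is the number of generators: of [k] nonnegative
coefficients with sum k + 1, one is at least 1, and the corresponding
generator can be removed from the exponent. *)
Lemma newton_step m b : newton 1 m -> newton k b ->
  exists i c, mnm_add m b = mnm_add (alpha i) c /\ newton k c.
Proof.
move=> [mu [mu0 smu muP]] [nu [nu0 snu nuP]].
have [i ] : exists i, 1 <= mu i + nu i.
  apply/existsP; rewrite -[[exists _, _]]negbK negb_exists; apply/negP=> /forallP lt1.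
  have : \sum_i (mu i + nu i) <= \sum_(i < k) 1.
    by apply: ler_sum => i _; rewrite ltW// ltNge lt1.
  by rewrite big_split /= smu snu sumr_const card_ord -natrD ler_nat add1n ltnn.
move=> le1; have aP j :
  (alpha i j)%:R + \sum_i' (mu i' + nu i' - (i' == i)%:R) * (alpha i' j)%:R <=
    (m j)%:R + (b j)%:R :> rat.
  apply: le_trans (lerD (muP j) (nuP j)).
  rewrite -(sum_delta_mul i (fun i' => (alpha i' j)%:R)) -!big_split /=.
  by rewrite le_eqVlt; apply/orP; left; apply/eqP/eq_bigr => i' _; ring.
have c0 i' : 0 <= mu i' + nu i' - (i' == i)%:R.
  by case: eqP => [->|_] /=; [rewrite subr_ge0 | rewrite subr0 addr_ge0].
have le_a j : (alpha i j <= m j + b j)%N.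
  rewrite -(ler_nat rat) natrD; apply: le_trans (aP j).
  by rewrite lerDl sumr_ge0// => i' _; rewrite mulr_ge0.
exists i, (mnm_sub (mnm_add m b) (alpha i)); split.
  by apply/mnmP=> j; rewrite !mnmDE mnmBE mnmDE subnKC.
exists (fun i' => mu i' + nu i' - (i' == i)%:R); split=> // [|j].
  by rewrite sumrB big_split /= smu snu sum_delta [1 + _]addrC addrK.
by rewrite mnmBE mnmDE natrB// natrD; have := aP j; lra.
Qed.

(** Bounds the coordinates of all the points sum_i mu_i alpha^i with mu_i >= 0
and sum_i mu_i = k. *)
Definition box := (k * \sum_i \sum_j alpha i j)%N.

(** The combination of the alpha^i below an exponent lies in the box, so it is
also below the truncated exponent.  Thus finitely many exponents generate all
the others. *)
Lemma newton_truncate c : newton k c ->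
  exists2 c' : {ffun 'I_n -> 'I_box.+1},
    newton k (Multinom [tuple val (c' j) | j < n]) &
    forall j, (c' j <= c j)%N.
Proof.
move=> [mu [mu0 smu muP]].
have lt_c j : (minn (c j) box < box.+1)%N by rewrite ltnS geq_minr.
exists [ffun j => Ordinal (lt_c j)] => [|j]; last by rewrite ffunE geq_minl.
exists mu; split=> // j; rewrite mnmE ffunE /= /minn; case: ifP => // _.
rewrite /box natrM natr_sum mulr_sumr; apply: ler_sum => i _.
apply: ler_pM; rewrite ?ler0n//.
  by rewrite -smu (bigD1 i)//= lerDl sumr_ge0.
by rewrite ler_nat (bigD1 j)//= leq_addr.
Qed.

Lemma newton_inhabited : (0 < k)%N -> exists c, newton k c.
Proof.
move=> k0; pose i0 := Ordinal k0.
exists (Multinom [tuple (k * alpha i0 j)%N | j < n]).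
exists (fun i => k%:R * (i == i0)%:R); split=> [i||j].
- by rewrite mulr_ge0.
- by rewrite -mulr_sumr sum_delta mulr1.
under eq_bigr do rewrite -mulrA; rewrite -mulr_sumr sum_delta_mul.
by rewrite mnmE natrM.
Qed.

End NewtonPolyhedron.

(** * A finitely generated ideal b with f b contained in a b *)

Section NewtonToModule.
Variables (K : idomainType) (n k : nat) (alpha : 'I_k -> multinom n).
Let a : set (mpoly n K) := ideal_gen (range (fun i => mpolyX K (alpha i))).

(** The monomials z^t with [t] in the box and in the dilated polyhedron.  The
family is indexed by the whole box, with 0 for the exponents outside the
polyhedron, so that the index is a plain finite type. *)
Lemma newton_module (f : mpoly n K) : (0 < k)%N ->
  (forall m, m \in msupp f -> newton alpha 1 m) ->
  exists (T : finType) (g : T -> mpoly n K),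
    (exists t, g t != 0) /\
    forall t, exists2 c : T -> mpoly n K, forall s, a (c s)
                                        & f * g t = \sum_s c s * g s.
Proof.
move=> k0 fN; have [a0 aD aM] : is_ideal a by apply: ideal_gen_ideal.
pose T : finType := {ffun 'I_n -> 'I_(box alpha).+1}.
pose mon (t : T) := Multinom [tuple val (t j) | j < n].
pose g t := if `[< newton alpha k (mon t) >] then mpolyX K (mon t) else 0.
exists T, g; split.
  have [c /newton_truncate[t tN _]] := newton_inhabited alpha k0.
  by exists t; rewrite /g asboolT// -msupp_eq0 msuppX.
move=> t; pose M h := exists2 c : T -> mpoly n K, forall s, a (c s)
                                              & h = \sum_s c s * g s.
rewrite -/(M (f * g t)).
have M0 : M 0 by exists (fun=> 0) => //; rewrite big1// => s _; rewrite mul0r.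
rewrite /g; case: asboolP => [tN|_]; last by rewrite mulr0.
rewrite [f]mpolyE mulr_suml big_seq; apply: (big_ind M) => // [|m mf].
  move=> _ _ [c ca ->] [d da ->]; exists (fun s => c s + d s) => [s|].
    exact: aD.
  by rewrite -big_split; apply: eq_bigr => s _; rewrite mulrDl.
have [i [c [mtE cN]]] := newton_step (fN m mf) tN.
have [s sN le_s] := newton_truncate cN.
pose r := mnm_sub c (mon s).
exists (fun s' => (s' == s)%:R * (mcoeff m f *: mpolyX K r * mpolyX K (alpha i))).
  have ai : a (mpolyX K (alpha i)) by apply: sub_ideal_gen; exists i.
  by move=> s'; exact: (aM _ _ (aM _ _ ai)).
under eq_bigr do rewrite -mulrA; rewrite sum_delta_mul /g asboolT//.
rewrite -!scalerAl -!mpolyXD; congr (_ *: mpolyX _ _).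
rewrite mtE; apply/mnmP=> j; rewrite !mnmDE mnmBE !mnmE.
by rewrite [RHS]addnAC (subnK (le_s j)) addnC.
Qed.

End NewtonToModule.

Lemma module_ideal (A : comNzRingType) (a : set A) (f : A)
    (T : finType) (g : T -> A) :
  (exists t, g t != 0) ->
  (forall t, exists2 c : T -> A, forall s, a (c s)
                               & f * g t = \sum_s c s * g s) ->
  exists b : set A,
    [/\ is_ideal b, b <> [set 0] & [set f * h | h in b] `<=` ideal_mul a b].
Proof.
move=> [t gt0] fg; exists (ideal_gen (range g)); split=> [|b0|_ [h bh <-]].
- exact: ideal_gen_ideal.
- have : ideal_gen (range g) (g t) by apply: sub_ideal_gen; exists t.
  by rewrite b0 /= => g0; rewrite g0 eqxx in gt0.
pose b := ideal_gen (range g); rewrite -/b.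
have abI : is_ideal (ideal_mul a b) by apply: ideal_gen_ideal.
have [ab0 abD abM] := abI.
apply: (@ideal_gen_min _ _ [set h | ideal_mul a b (f * h)]) bh.
  split=> /= [|x y fx fy|x y fy]; first by rewrite mulr0.
    by rewrite mulrDr; apply: abD.
  by rewrite mulrCA; apply: abM.
move=> _ [s _ <-] /=; have [c ca ->] := fg s.
apply: ideal_sum => // s' _; apply: ideal_mul_mem => //.
by apply: sub_ideal_gen; exists s'.
Qed.

(** * Weights from an ideal b with f b contained in a b *)

Section WeightGrading.
Variables (K : idomainType) (n : nat) (w : 'I_n -> nat).

(** The substitution z_j := z_j X^(w j), whose coefficient at X^d is the part
of w-degree [d].  As a morphism into polynomials over a domain, it makes the
lowest w-degree additive on products. *)
Definition weight_poly : mpoly n K -> {poly mpoly n K} :=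
  mmap (polyC \o @mpolyC n K)
    (fun j => (mpolyX K (mnm1 j))%:P * 'X^(w j)).

Lemma weight_polyD : {morph weight_poly : f g / f + g}.
Proof. exact: mmapD. Qed.

Lemma weight_polyM : {morph weight_poly : f g / f * g}.
Proof. by move=> f g; have [+ _] := mmap_is_multiplicative
  (fun j => (mpolyX K (mnm1 j))%:P * 'X^(w j)) (polyC \o @mpolyC n K); apply. Qed.

Lemma weight_polyX m :
  weight_poly (mpolyX K m) = (mpolyX K m)%:P * 'X^(wdeg w m).
Proof.
rewrite /weight_poly mmapX /mmap1.
under eq_bigr do rewrite exprMn -exprM -rmorphXn.
rewrite big_split /= -rmorph_prod -mpolyXE_id; congr (_ * _).
by rewrite -expr_sum.
Qed.

Lemma mcoeff_weight_poly f d m :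
  mcoeff m (weight_poly f)`_d = if wdeg w m == d then mcoeff m f else 0.
Proof.
have fE : weight_poly f =
    \sum_(m <- msupp f) (mcoeff m f *: mpolyX K m)%:P * 'X^(wdeg w m).
  rewrite {1}[f]mpolyE /weight_poly rmorph_sum /=; apply: eq_bigr => m' _.
  by rewrite mmapZ -/(weight_poly _) weight_polyX /= mulrA -polyCM mul_mpolyC.
rewrite fE coef_sum raddf_sum /=.
rewrite (eq_bigr (fun m' => (wdeg w m == d)%:R *
    mcoeff m (mcoeff m' f *: mpolyX K m'))) => [|m' _].
  rewrite -mulr_sumr -raddf_sum -mpolyE.
  by case: eqP; rewrite ?mul1r ?mul0r.
rewrite coefCM coefXn mulr_natr mcoeffMn mulr_natl mcoeffZ mcoeffX.
case: (eqVneq m' m) => [->|_]; first by rewrite eq_sym.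
by rewrite mulr0 !mul0rn.
Qed.

End WeightGrading.

Section OrderAtZero.
Variable A : nzRingType.
Implicit Types P Q : {poly A}.

Definition order_ge (d : nat) P : Prop := forall i, (i < d)%N -> P`_i = 0.

Lemma order_ge_mul d e P Q :
  order_ge d P -> order_ge e Q -> order_ge (d + e) (P * Q).
Proof.
move=> P0 Q0 i lt_i; rewrite coefM big1// => -[j /= le_j] _.
have [/P0->|le_d] := ltnP j d; first by rewrite mul0r.
by rewrite Q0 ?mulr0//; lia.
Qed.

Lemma coefM_order d e P Q :
  order_ge d P -> order_ge e Q -> (P * Q)`_(d + e) = P`_d * Q`_e.
Proof.
move=> P0 Q0; have lt_d : (d < (d + e).+1)%N by rewrite ltnS leq_addr.
rewrite coefM (bigD1 (Ordinal lt_d))//= addKn big1 ?addr0// => -[j /= le_j].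
rewrite -val_eqE /= => ne_j; have [/P0->|le_d] := ltnP j d; first by rewrite mul0r.
by rewrite Q0 ?mulr0//; lia.
Qed.

End OrderAtZero.

Section WeightsOfModule.
Variables (K : idomainType) (n k : nat) (alpha : 'I_k -> multinom n).
Let a : set (mpoly n K) := ideal_gen (range (fun i => mpolyX K (alpha i))).

Lemma weight_poly_neq0 w m (f : mpoly n K) :
  m \in msupp f -> (weight_poly w f)`_(wdeg w m) != 0.
Proof.
rewrite mcoeff_msupp; apply: contraNneq => wf0.
by have := mcoeff_weight_poly w f (wdeg w m) m; rewrite wf0 eqxx mcoeff0 => <-.
Qed.

Lemma weight_order_ideal w d :
  is_ideal [set h : mpoly n K | order_ge d (weight_poly w h)].
Proof.
split=> /= [i _|x y x0 y0 i lt_i|x y y0].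
- by rewrite /weight_poly raddf0 coef0.
- by rewrite weight_polyD coefD [X in X + _]x0// [X in _ + X]y0// addr0.
- have x0 : order_ge 0 (weight_poly w x) by move=> i; rewrite ltn0.
  by rewrite weight_polyM; apply: (order_ge_mul x0 y0).
Qed.

(** If all the generators of [a] had w-degree larger than the exponent [m] of
[f], then [f] would have w-order s < e, where [e] is a lower bound for the
w-order on [a].  Let [d] be the least w-order on [b], attained at [g].  Then
f g has w-order s + d, whereas the w-order on a b is at least e + d. *)
Lemma weights_of_module (b : set (mpoly n K)) f :
  is_ideal b -> b <> [set 0] -> [set f * g | g in b] `<=` ideal_mul a b ->
  forall m w, m \in msupp f -> exists i, (wdeg w (alpha i) <= wdeg w m)%N.
Proof.
move=> bI b_neq0 fb m w mf; apply/existsP; apply/contraT.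
rewrite negb_exists => /forallP aw; pose wp := @weight_poly K n w.
pose e := (wdeg w m).+1.
have aE x : a x -> order_ge e (wp x).
  apply: (ideal_gen_min (weight_order_ideal w e)) => _ [i _ <-] /= j lt_j.
  rewrite weight_polyX coefCM coefXn; case: eqP => [jE|_]; last by rewrite mulr0.
  by have := aw i; rewrite -ltnNge -jE ltnNge -ltnS lt_j.
have [s fs s_min] :=
  ex_minnP (ex_intro (fun s => (wp f)`_s != 0) _ (weight_poly_neq0 w mf)).
have /ex_minnP[d /asboolP[g bg gd] d_min] :
    exists d, `[< exists2 g, b g & (wp g)`_d != 0 >].
  have [g bg g0] : exists2 g, b g & g != 0.
    apply: contrapT => bN; apply: b_neq0; apply/seteqP; split=> [g bg|_ ->].
      by apply/eqP; apply: contrapT => /negP g0; apply: bN; exists g.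
    by case: bI.
  have [m' m'g] : exists m', m' \in msupp g.
    by case: (msupp g) (msupp_eq0 g) g0 => [<-//|m' s' _ _]; exists m'; apply: mem_head.
  by exists (wdeg w m'); apply/asboolP; exists g => //; apply: weight_poly_neq0.
have bd x : b x -> order_ge d (wp x).
  move=> bx i lt_i; apply/eqP; apply: contraTT lt_i => xi; rewrite -leqNgt.
  by apply: d_min; apply/asboolP; exists x.
have fs' : order_ge s (wp f).
  by move=> i lt_i; apply/eqP; apply: contraTT lt_i; rewrite -leqNgt; apply: s_min.
have : order_ge (e + d) (wp (f * g)).
  have : ideal_mul a b (f * g) by apply: fb; exists g.
  apply: (ideal_gen_min (weight_order_ideal w (e + d))) => _ [x ax [y bY <-]] /=.
  rewrite weight_polyM; apply: order_ge_mul; [exact: aE | exact: bd].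
move=> /(_ (s + d)%N); rewrite ltn_add2r ltnS s_min; last exact: weight_poly_neq0.
move=> /(_ isT); rewrite /wp weight_polyM (coefM_order fs' (bd g bg)).
by move/eqP; rewrite mulf_eq0 (negPf fs) (negPf gd).
Qed.

End WeightsOfModule.

(** * Weights from the growth along monomial curves *)

Section WeightRefinement.
Variable n : nat.

Lemma digits_inj N B (x y : nat -> nat) :
  (forall j, (j < N)%N -> (x j < B)%N) -> (forall j, (j < N)%N -> (y j < B)%N) ->
  (\sum_(j < N) B ^ j * x j = \sum_(j < N) B ^ j * y j)%N ->
  forall j, (j < N)%N -> x j = y j.
Proof.
elim: N x y => // N IHN x y xB yB.
have splitE (z : nat -> nat) : (\sum_(j < N.+1) B ^ j * z j =
    (\sum_(j < N) B ^ j * z j.+1) * B + z 0)%N.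
  rewrite big_ord_recl /= expn0 mul1n addnC big_distrl; congr (_ + _)%N.
  by apply: eq_bigr => j _; rewrite /bump leq0n add1n expnS -mulnA mulnC.
rewrite !splitE => xy.
have xy0 : x 0%N = y 0%N.
  move/(congr1 (modn^~ B)): (xy).
  by rewrite !modnMDl !modn_small//; [apply: yB | apply: xB].
have B0 : (0 < B)%N by apply: leq_ltn_trans (xB 0%N isT).
move/eqP: xy; rewrite xy0 eqn_add2r eqn_pmul2r// => /eqP xy.
case=> // j lt_j; apply: (IHN (x \o succn) (y \o succn)) => // i lt_i.
  exact: xB.
exact: yB.
Qed.

(** Powers of a base larger than all the exponents: by uniqueness of digits,
distinct exponents get distinct weights (Kronecker substitution). *)
Lemma injective_weights (s : seq (multinom n)) :
  exists2 v : 'I_n -> nat, forall j, (0 < v j)%N & {in s &, injective (wdeg v)}.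
Proof.
pose B := (\sum_(m <- s) \sum_j m j).+1.
have sB m j : m \in s -> (m j < B)%N.
  move=> ms; rewrite ltnS (perm_big _ (perm_to_rem ms)) big_cons.
  by rewrite (bigD1 j)//= -addnA leq_addr.
exists (fun j => B ^ j)%N => [j|m m' ms m's vE]; first by rewrite expn_gt0.
apply/mnmP=> j; rewrite !(mnm_nth 0%N).
apply: (@digits_inj n B) (ltn_ord j) => [i lt_i|i lt_i|].
- by have := sB m (Ordinal lt_i) ms; rewrite (mnm_nth 0%N).
- by have := sB m' (Ordinal lt_i) m's; rewrite (mnm_nth 0%N).
- move: vE; rewrite /wdeg; under eq_bigr do rewrite (mnm_nth 0%N).
  by under [in RHS]eq_bigr do rewrite (mnm_nth 0%N).
Qed.

(** A large multiple of [w] plus a separating weight: [w] decides first, and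
the second summand breaks the ties.  Positivity is what makes the monomial
curve of weight [v] tend to the origin. *)
Lemma refine_weights (w : 'I_n -> nat) (s : seq (multinom n)) :
  exists v : 'I_n -> nat, [/\ forall j, (0 < v j)%N, {in s &, injective (wdeg v)}
    & {in s &, forall m m', (wdeg w m < wdeg w m')%N -> (wdeg v m < wdeg v m')%N}].
Proof.
have [v v0 v_inj] := injective_weights s.
pose B := (\sum_(m <- s) wdeg v m).+1.
have sB m : m \in s -> (wdeg v m < B)%N.
  by move=> ms; rewrite ltnS (perm_big _ (perm_to_rem ms)) big_cons leq_addr.
have BE m : wdeg (fun j => w j * B + v j)%N m = (wdeg w m * B + wdeg v m)%N.
  rewrite /wdeg big_distrl -big_split; apply: eq_bigr => j _ /=.
  by rewrite mulnDl mulnAC.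
exists (fun j => w j * B + v j)%N; split=> [j|m m' ms m's|m m' ms m's ltw].
- by rewrite addn_gt0 v0 orbT.
- rewrite !BE => /(congr1 (modn^~ B)).
  by rewrite !modnMDl !modn_small ?sB//; apply: v_inj.
rewrite !BE; apply: (@leq_trans ((wdeg w m).+1 * B)%N).
  by rewrite mulSn addnC ltn_add2r sB.
by apply: leq_trans (leq_addr _ _); rewrite leq_mul2r ltw orbT.
Qed.

End WeightRefinement.

Section MonomialCurve.
Variables (K : numFieldType) (n : nat) (v : 'I_n -> nat).

Definition monomial_curve (t : K) : 'I_n -> K := fun j => t ^+ v j.

Lemma meval_monomial_curve t m :
  meval (monomial_curve t) (mpolyX K m) = t ^+ wdeg v m.
Proof.
by rewrite mevalX /wdeg expr_sum; apply: eq_bigr => j _; rewrite exprM.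
Qed.

(** As [m0] is the only exponent of least weight, all the other terms of [f]
are of order at least one more in [t]. *)
Lemma curve_lower_bound (f : mpoly n K) m0 t :
  m0 \in msupp f ->
  {in msupp f, forall m, m != m0 -> (wdeg v m0 < wdeg v m)%N} ->
  0 <= t -> t <= 1 ->
  `|mcoeff m0 f| * t ^+ wdeg v m0 <=
    `|meval (monomial_curve t) f|
    + (\sum_(m <- msupp f) `|mcoeff m f|) * t ^+ (wdeg v m0).+1.
Proof.
move=> m0f m0_min t0 t1.
have fE : meval (monomial_curve t) f =
    \sum_(m <- msupp f) mcoeff m f * t ^+ wdeg v m.
  rewrite {1}[f]mpolyE raddf_sum; apply: eq_bigr => m _ /=.
  by rewrite mevalZ meval_monomial_curve.
rewrite fE -lerBlDr mulr_suml !(perm_big _ (perm_to_rem m0f)) !big_cons /=.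
rewrite lerBlDr; set S := \sum_(m <- _) _; set S' := \sum_(m <- _) _.
have SS' : `|S| <= S'.
  rewrite /S; apply: le_trans; first exact: ler_norm_sum.
  rewrite /S' big_seq [leRHS]big_seq.
  apply: ler_sum => m; rewrite mem_rem_uniq ?msupp_uniq// inE => /andP[mm0 mf].
  rewrite normrM ler_wpM2l// ger0_norm ?exprn_ge0//.
  by rewrite ler_wiXn2l// m0_min.
apply: (@le_trans _ _ (`|mcoeff m0 f * t ^+ wdeg v m0 + S| + `|S|)).
  rewrite -{1}(ger0_norm (exprn_ge0 (wdeg v m0) t0)) -normrM.
  by rewrite -lerBlDr; exact: lerB_normD.
rewrite lerD2l; apply: le_trans SS' _; rewrite lerDr.
by rewrite mulr_ge0// exprn_ge0.
Qed.

End MonomialCurve.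

(** The value e / (1 + e) * (c / (c + D)) avoids a minimum, so that the lemma
holds in partially ordered fields such as the complex numbers. *)
Lemma exists_small_parameter (K : numFieldType) (c D e : K) :
  0 < c -> 0 <= D -> 0 < e ->
  exists t, [/\ 0 < t, t < e, t <= 1 & D * t < c].
Proof.
move=> c0 D0 e0; pose u := e / (1 + e); pose r := c / (c + D).
have e1 : 0 < 1 + e by rewrite addr_gt0.
have cD : 0 < c + D by rewrite ltr_wpDr.
have u0 : 0 < u by rewrite divr_gt0.
have u1 : u < 1 by rewrite ltr_pdivrMr// mul1r ltrDr.
have ue : u < e by rewrite ltr_pdivrMr// mulrDr mulr1 ltrDl mulr_gt0.
have r0 : 0 < r by rewrite divr_gt0.
have r1 : r <= 1 by rewrite ler_pdivrMr// mul1r lerDl.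
exists (u * r); split.
- exact: mulr_gt0.
- by apply: le_lt_trans ue; rewrite ler_piMr// ltW.
- by rewrite mulr_ile1// ltW.
have Dr : D * r <= c.
  by rewrite mulrCA ler_piMr ?(ltW c0)// ler_pdivrMr// mul1r lerDr ltW.
rewrite mulrCA; have [D0'|D0'] := eqVneq D 0; first by rewrite D0' mul0r mulr0.
by apply: lt_le_trans Dr; rewrite gtr_pMl// mulr_gt0// lt_neqAle eq_sym D0'.
Qed.

Lemma seq_argmin (T : eqType) (F : T -> nat) (s : seq T) x : x \in s ->
  exists2 y, y \in s & {in s, forall z, (F y <= F z)%N}.
Proof.
move=> xs; have : exists d, has (fun y => F y == d) s.
  by exists (F x); apply/hasP; exists x.
case/ex_minnP => d /hasP[y ys /eqP <-] d_min; exists y => // z zs.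
by apply: d_min; apply/hasP; exists z.
Qed.

Section AnalyticToWeights.
Variables (R : realType) (n k : nat) (alpha : 'I_k -> multinom n).

(** Otherwise all the generators of the ideal are O(t^(s + 1)) on the curve of
weight [v], with [s] the least v-weight of the exponents of [f], while [f] has
exact order [s] there. *)
Lemma weights_of_an_closure (f : mpoly n R[i]) :
  an_closure (fun i => mpolyX R[i] (alpha i)) f ->
  forall m w, m \in msupp f -> exists i, (wdeg w (alpha i) <= wdeg w m)%N.
Proof.
move=> fan m w mf; apply/existsP; apply/contraT.
rewrite negb_exists => /forallP aw.
have [v [v0 v_inj v_lt]] := refine_weights w (msupp f ++ codom alpha).
have in_f m' : m' \in msupp f -> m' \in msupp f ++ codom alpha.
  by rewrite mem_cat => ->.
have in_a i : alpha i \in msupp f ++ codom alpha.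
  by rewrite mem_cat codom_f orbT.
have [m0 m0f m0_min] := seq_argmin (wdeg v) mf.
have m0_lt : {in msupp f, forall m', m' != m0 -> (wdeg v m0 < wdeg v m')%N}.
  move=> m' m'f m'm0; rewrite ltn_neqAle m0_min// andbT.
  by apply: contraNneq m'm0 => /v_inj->//; apply: in_f.
have m0_a i : (wdeg v m0 < wdeg v (alpha i))%N.
  apply: (leq_ltn_trans (m0_min m mf)); apply: (v_lt _ _ (in_f m mf) (in_a i)).
  by rewrite ltnNge aw.
have [C C0 /nbhs_ballP[e /= e0 eC]] := fan 0.
have C0' : 0 <= C%:C :> R[i] by rewrite ler0c ltW.
pose S : R[i] := \sum_(m' <- msupp f) `|mcoeff m' f|.
have c0 : 0 < `|mcoeff m0 f| by rewrite normr_gt0 -mcoeff_msupp.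
have D0 : 0 <= C%:C * k%:R + S.
  by rewrite addr_ge0 ?mulr_ge0// sumr_ge0.
have [t [t0 te t1 Dt]] := exists_small_parameter c0 D0 e0.
have := eC (\row_j (t ^+ v j : R[i]^o)).
have zE g : meval ((\row_j (t ^+ v j : R[i]^o)) 0) g = meval (monomial_curve v t) g.
  by apply: meval_eq => j; rewrite mxE.
rewrite /= zE => /(_ _)/wrap[].
  split=> // i j; rewrite -ball_normE /ball_ /= !mxE sub0r normrN.
  rewrite ger0_norm ?exprn_ge0 ?(ltW t0)//; apply: le_lt_trans te.
  by rewrite -[leRHS]expr1 ler_wiXn2l ?v0// ltW.
move=> ft.
have upper : `|meval (monomial_curve v t) f| + S * t ^+ (wdeg v m0).+1 <=
    (C%:C * k%:R + S) * t ^+ (wdeg v m0).+1.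
  rewrite mulrDl lerD2r; apply: le_trans ft _; rewrite -mulrA ler_wpM2l//.
  have -> : k%:R * t ^+ (wdeg v m0).+1 = \sum_(i < k) t ^+ (wdeg v m0).+1.
    by rewrite sumr_const card_ord mulr_natl.
  apply: ler_sum => i _; rewrite zE meval_monomial_curve.
  rewrite ger0_norm ?exprn_ge0 ?(ltW t0)//.
  by rewrite ler_wiXn2l ?m0_a// ltW.
have := le_trans (curve_lower_bound m0f m0_lt (ltW t0) t1) upper.
rewrite exprS mulrA ler_pM2r ?exprn_gt0// => /(lt_le_trans Dt).
by rewrite ltxx.
Qed.

End AnalyticToWeights.

(** * Growth of integral elements *)

Section GrowthOnBoundedSets.
Variables (K : numFieldType) (n k : nat) (p : 'I_k -> mpoly n K).
Variable V : set ('I_n -> K).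
Hypothesis V_bounded : forall f, exists2 C, 0 <= C
  & forall z, V z -> `|meval z f| <= C.
Let S z := \sum_i `|meval z (p i)|.

Let S_ge0 z : 0 <= S z.
Proof. by apply: sumr_ge0. Qed.

Definition growth (j : nat) (f : mpoly n K) : Prop :=
  exists2 C, 0 <= C & forall z, V z -> `|meval z f| <= C * S z ^+ j.

Lemma growthM i j f g : growth i f -> growth j g -> growth (i + j) (f * g).
Proof.
move=> [C C0 Cf] [D D0 Dg]; exists (C * D) => [|z Vz]; first exact: mulr_ge0.
by rewrite mevalM normrM exprD mulrACA ler_pM ?Cf ?Dg.
Qed.

Lemma growth_ideal j : is_ideal [set f | growth j f].
Proof.
split=> /= [|f g [C C0 Cf] [D D0 Dg]|f g gg].
- by exists 0 => // z _; rewrite meval0 normr0 mul0r.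
- exists (C + D) => [|z Vz]; first exact: addr_ge0.
  by rewrite mevalD mulrDl (le_trans (ler_normD _ _))// lerD ?Cf ?Dg.
rewrite -[j]add0n; apply: growthM => //.
have [C C0 CV] := V_bounded f; exists C => // z Vz.
by rewrite expr0 mulr1; apply: CV.
Qed.

Lemma growth_ideal_exp j f : ideal_exp (ideal_gen (range p)) j f -> growth j f.
Proof.
elim: j f => [|j IHj] f.
  move=> _; have [C C0 CV] := V_bounded f; exists C => // z Vz.
  by rewrite expr0 mulr1; apply: CV.
apply: (ideal_gen_min (growth_ideal j.+1)) => _ [g ag [h ah <-]] /=.
rewrite -add1n; apply: growthM; last exact: IHj.
apply: (ideal_gen_min (growth_ideal 1)) ag => _ [i _ <-] /=.
exists 1 => // z _; rewrite mul1r expr1 /S (bigD1 i)//= lerDl.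
exact: sumr_ge0.
Qed.

End GrowthOnBoundedSets.

(** If |y| exceeded (1 + D) s, where D = sum_j C_j, each term |b_j y^(N - j)|
would be at most C_j / (1 + D) |y|^N, and the terms together could not reach
|y|^N. *)
Lemma integral_bound (K : numFieldType) (N : nat) (y s : K) (b C : nat -> K) :
  (0 < N)%N -> 0 <= s -> (forall j, 0 <= C j) ->
  (forall j, (1 <= j <= N)%N -> `|b j| <= C j * s ^+ j) ->
  y ^+ N + \sum_(1 <= j < N.+1) b j * y ^+ (N - j) = 0 ->
  `|y| <= (1 + \sum_(1 <= j < N.+1) C j) * s.
Proof.
move=> N0 s0 C0 bC yN; set D := \sum_(1 <= j < N.+1) C j.
have D0 : 0 <= D by apply: sumr_ge0.
have D1 : 1 <= 1 + D by rewrite lerDl.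
rewrite real_leNgt ?normr_real// ?ger0_real ?mulr_ge0 ?addr_ge0//.
apply/negP => lt_y; have y0 : 0 < `|y|.
  by apply: le_lt_trans lt_y; rewrite mulr_ge0 ?addr_ge0.
have bound j : (1 <= j < N.+1)%N -> (1 + D) * `|b j * y ^+ (N - j)| <= C j * `|y| ^+ N.
  move=> /andP[j1 jN]; rewrite normrM normrX -(subnKC (jN : (j <= N)%N)).
  rewrite exprD [(j + _ - j)%N]addKn mulrA [leRHS]mulrA ler_wpM2r ?exprn_ge0//.
  apply: (@le_trans _ _ ((1 + D) * (C j * s ^+ j))).
    by rewrite ler_wpM2l ?addr_ge0// bC// j1.
  rewrite mulrCA ler_wpM2l//; apply: (@le_trans _ _ (((1 + D) * s) ^+ j)).
    by rewrite exprMn ler_wpM2r ?exprn_ge0// -{1}[1 + D]expr1 ler_weXn2l.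
  by rewrite lerXn2r ?nnegrE ?mulr_ge0 ?addr_ge0// ltW.
have : (1 + D) * `|y| ^+ N <= D * `|y| ^+ N.
  rewrite -normrX (_ : y ^+ N = - \sum_(1 <= j < N.+1) b j * y ^+ (N - j)); last first.
    by apply/eqP; rewrite -addr_eq0 yN.
  rewrite {1}normrN; apply: (@le_trans _ _
    ((1 + D) * \sum_(1 <= j < N.+1) `|b j * y ^+ (N - j)|)).
    by rewrite ler_wpM2l ?addr_ge0// ler_norm_sum.
  rewrite -(_ : y ^+ N = - _); last by apply/eqP; rewrite -addr_eq0 yN.
  rewrite mulr_sumr mulr_suml normrX big_nat_cond [leRHS]big_nat_cond.
  by apply: ler_sum => j /andP[jN _]; apply: bound.
by rewrite ler_pM2r ?exprn_gt0// gerDr ler10.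
Qed.

Lemma meval_bounded (K : numFieldType) (n : nat) (M : K) (f : mpoly n K) :
  0 <= M -> exists2 C, 0 <= C
    & forall z, (forall j, `|z j| <= M) -> `|meval z f| <= C.
Proof.
move=> M0; exists (\sum_(m <- msupp f) `|mcoeff m f| * \prod_j M ^+ m j).
  by apply: sumr_ge0 => m _; rewrite mulr_ge0// prodr_ge0// => j _; rewrite exprn_ge0.
move=> z zM; rewrite mevalE; apply: le_trans (ler_norm_sum _ _ _) _.
apply: ler_sum => m _; rewrite normrM normr_prod ler_wpM2l// ler_prod// => j _.
by rewrite normr_ge0 normrX lerXn2r ?nnegrE.
Qed.

(** The estimate holds uniformly on the unit ball around [q], the constant
depending only on the bounds for the coefficients of the equation there. *)
Lemma an_closure_of_al_closure (R : realType) (n k : nat)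
    (p : 'I_k -> mpoly n R[i]) f :
  al_closure (ideal_gen (range p)) f -> an_closure p f.
Proof.
move=> [N [b [N0 ab fN]]] q.
pose M : R[i] := 1 + \sum_j `|q 0 j|.
have M0 : 0 <= M by rewrite addr_ge0// sumr_ge0.
pose V : set ('I_n -> R[i]) := [set z | forall j, `|z j| <= M].
have V_bounded g : exists2 C, 0 <= C & forall z, V z -> `|meval z g| <= C.
  exact: meval_bounded.
have /choice[C Cb] : forall j, exists C, 0 <= C /\
    ((1 <= j <= N)%N -> forall z, V z ->
      `|meval z (b j)| <= C * (\sum_i `|meval z (p i)|) ^+ j).
  move=> j; case: (boolP (1 <= j <= N)%N) => [jN|_]; last by exists 0.
  by have [C C0 CV] := growth_ideal_exp V_bounded (ab j jN); exists C.
pose D := 1 + \sum_(1 <= j < N.+1) C j.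
have D0 : 0 < D by rewrite ltr_wpDr// sumr_ge0// => j _; have [] := Cb j.
have DE : D = (complex.Re D)%:C by rewrite RRe_real// ger0_real// ltW.
exists (complex.Re D); first by rewrite -ltcR -DE.
apply/nbhs_ballP; exists 1 => //= z qz; rewrite -DE.
have Vz : V (z 0).
  move=> j; have [_ /(_ 0 j)] := qz; rewrite -ball_normE /ball_ /= => /ltW qzj.
  rewrite -[z 0 j](subKr (q 0 j)) (le_trans (ler_normB _ _))// addrC lerD//.
  by rewrite (bigD1 j)//= lerDl sumr_ge0.
apply: (@integral_bound _ N _ _ (fun j => meval (z 0) (b j))) => //.
- exact: sumr_ge0.
- by move=> j; have [] := Cb j.
- by move=> j jN; have [_] := Cb j; apply.
rewrite -rmorphXn -[RHS](meval0 (z 0)) -fN mevalD rmorph_sum /=; congr (_ + _).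
by apply: eq_bigr => j _; rewrite mevalM rmorphXn.
Qed.

(** * The theorem *)

Theorem theorem4p8 (R : realType) (n k : nat) (hk : (0 < k)%N)
    (alpha : 'I_k -> multinom n) (f : mpoly n R[i]) :
  let p := fun i : 'I_k => mpolyX R[i] (alpha i) in
  let a := ideal_gen (range p) in
  (an_closure p f <-> al_closure a f) /\
  (al_closure a f <->
   exists b : set (mpoly n R[i]),
     [/\ is_ideal b, b <> [set 0] & [set f * g | g in b] `<=` ideal_mul a b]).
Proof.
move=> p a.
pose weights := forall m w, m \in msupp f ->
  exists i, (wdeg w (alpha i) <= wdeg w m)%N.
have module : weights -> exists (T : finType) (g : T -> mpoly n R[i]),
    (exists t, g t != 0) /\ forall t, exists2 c : T -> mpoly n R[i],
      forall s, a (c s) & f * g t = \sum_s c s * g s.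
  move=> fw; apply: newton_module => // m mf.
  by apply: newton_of_weights => w; apply: fw.
have al_of_weights : weights -> al_closure a f.
  move=> /module[T [g [[t gt0] fg]]].
  exact: determinant_trick (ideal_gen_ideal _) gt0 fg.
split; split.
- by move/weights_of_an_closure.
- exact: an_closure_of_al_closure.
- move=> /an_closure_of_al_closure/weights_of_an_closure/module[T [g [g0 fg]]].
  exact: module_ideal g0 fg.
- by move=> [b [bI b0 fb]]; apply/al_of_weights/(weights_of_module bI b0 fb).
Qed.
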